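(* Let $G$ be a $K_4$-free graph on $n$ vertices, where $n$ is even and $n > 10^5$. Then $D_{2,\infty}^b(G) < 0.074\, n^2$.
   Context: All graphs are simple. For a vertex subset $A$, $e(A)$ is the number of edges with both endpoints in $A$, and $A^c = V(G)\setminus A$. For a graph $G$ on an even number of vertices, $D_{2,\infty}^b(G) = \min \max\{e(A), e(A^c)\}$, the minimum taken over all partitions $V(G) = A \cup A^c$ with $|A| = |A^c|$. A graph is $K_4$-free if it contains no complete graph on 4 vertices as a subgraph. *)

(* Defs.v *)
From mathcomp Require Import all_boot.

Set Implicit Arguments.
Unset Strict Implicit.
Unset Printing Implicit Defensive.

(* A simple graph is a symmetric irreflexive adjacency relation [e] on a finite
   vertex type [V]. The definitions below are meant for such relations. *)

Section Graph.

Variables (V : finType) (e : rel V).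

Definition edges : {set {set V}} :=
  [set E | [exists x, exists y, e x y && (E == [set x; y])]].

Definition edges_in (A : {set V}) : nat := #|[set E in edges | E \subset A]|.

Definition clique (K : {set V}) : bool :=
  [forall x in K, forall y in K, (x != y) ==> e x y].

Definition K4_free : Prop := ~ exists2 K : {set V}, #|K| = 4 & clique K.

Definition balanced (A : {set V}) : bool := #|A| == #|~: A|.

(* The default value [#|edges|] bounds every term, so it does not affect the
   minimum as soon as a balanced set exists, i.e. as soon as [#|V|] is even
   (see [D2bP]). *)
Definition D2b : nat :=
  \big[minn/#|edges|]_(A : {set V} | balanced A)
    maxn (edges_in A) (edges_in (~: A)).

Lemma balanced_exists : ~~ odd #|V| -> exists A : {set V}, balanced A.
Proof.
move=> Vev; have hV : #|V|./2 <= #|[set: V]| by rewrite cardsT -{2}(odd_double_half #|V|) -addnn addnA leq_addl.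
have [A [_ cA]] : exists A : {set V}, A \subset [set: V] /\ #|A| = #|V|./2.
  have /card_gt0P [A] : 0 < #|[set A : {set V} | A \subset [set: V] & #|A| == #|V|./2]|.
    by rewrite cards_draws bin_gt0.
  by rewrite inE => /andP[sA /eqP cA]; exists A.
exists A; rewrite /balanced -(eqn_add2l #|A|) cardsC cA addnn.
by rewrite even_halfK.
Qed.

Lemma D2bP : ~~ odd #|V| ->
  (exists2 A : {set V}, balanced A
     & D2b = maxn (edges_in A) (edges_in (~: A))) /\
  (forall A : {set V}, balanced A ->
     D2b <= maxn (edges_in A) (edges_in (~: A))).
Proof.
move=> /balanced_exists [A0 bA0].
have lb A : balanced A -> D2b <= maxn (edges_in A) (edges_in (~: A)).
  move=> bA; rewrite /D2b; have := mem_index_enum A.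
  elim: (index_enum _) => // B s IHs; rewrite inE big_cons => /orP[/eqP <-|As].
    by rewrite bA geq_minl.
  by case: ifP => _; rewrite ?(leq_trans (geq_minr _ _)) ?IHs.
split=> //.
have ub A : edges_in A <= #|edges|.
  by apply/subset_leq_card/subsetP => E; rewrite inE => /andP[].
have [|D] : D2b = #|edges| \/ exists2 A : {set V}, balanced A
     & D2b = maxn (edges_in A) (edges_in (~: A)).
- rewrite /D2b; elim/big_ind: _ => [|x y Hx Hy|A bA]; first by left.
    by rewrite /minn; case: ifP.
  by right; exists A.
- move=> D; exists A0 => //; apply/eqP.
  by rewrite eqn_leq lb //= D geq_max !ub.
by [].
Qed.

End Graph.

(* Main.v *)
(* A fractional bisection gives each vertex v a weight p_v in [0,1], with sum n/2,
   and has e(A) = sum of p_u p_v over the edges uv. Shifting weight t between two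
   vertices changes e(A) by a linear term minus a nonnegative multiple of t^2, so p
   can be rounded to an honest set without increasing e(A); doing so along the
   vertices sorted by degree lowers the degree sum of A by at most n, hence raises
   e(A^c) by at most n. It remains to find good fractional bisections.
   If e(G) <= (34/115) n^2, take p = 1/2. Otherwise let x have maximum degree, let
   y have maximum degree inside N(x), and put V1 = V \ N(x), V2 = N(x) \ N(y),
   V3 = N(x) n N(y), which is independent as G is K4-free. Counting degrees on V1,
   V2 and N(x), as in Furedi's proof of stability, leaves few edges inside V1 and
   V2. Then one of the bisections (V1 + part of V3 | V2 + rest of V3),
   (V2 + part of V1 | V3 + rest of V1) and, when |V3| > n/2,
   (V1 + V2 + part of V3 | rest of V3) works. *)
Require Import Defs.
From mathcomp Require Import all_boot all_order all_algebra.
From mathcomp Require Import ring lra.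

Import Order.TTheory GRing.Theory Num.Theory.
Local Open Scope ring_scope.

Set Implicit Arguments.
Unset Strict Implicit.
Unset Printing Implicit Defensive.

(* [tau] is just below 74 / 1000, to absorb the rounding error [n]; a uniform
   fractional bisection costs a quarter of the edges, whence [emin = 4 * tau]. *)
Local Notation tau := (17 / 230).
Local Notation emin := (34 / 115).

(** * Choosing the weights of the three parts *)

Section BisectionWeights.
Variable R : realFieldType.
Implicit Types a b c : R.

(* [gap x] is what [tau] leaves above the density [x * (1 / 2 - x)] of a complete
   bipartite graph between a part [x] and the rest of its half; [excess a b c]
   bounds the density of the edges inside the parts. *)
Local Notation gap x := (tau - x * (1 / 2 - x)).
Local Notation excess a b c := (a * b + a * c + b * c - emin).

(** * Polynomial inequalities between the part sizes *)

Lemma gap_ge (x : R) : 1 / 88 <= gap x.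
Proof. by have := sqr_ge0 (x - 1/4); lra. Qed.

Lemma excess_le a b c : a + b + c = 1 -> excess a b c <= 19 / 500.
Proof.
move=> abc; have -> : c = 1 - a - b by lra.
have := sqr_ge0 (a - 1/3); have := sqr_ge0 (b - 1/3).
have := sqr_ge0 (a + b - 2/3); nra.
Qed.

(** Serves [split1_cost] with [z = 1/2 - c], the share of V1 in its half. The bound [47/115] is
    [1 - 2 * emin]: the maximum degree is at least the average degree. *)
Lemma sqr_mul_excess_le a z : 0 < a -> a <= 47/115 -> 0 <= z ->
  z ^+ 2 * ((1 - a) * (a + (1/2 - z) / 2) - emin) <= (tau - 1/16) * a ^+ 2.
Proof.
move=> a0 a1 z0.
(* As a convex function of [z ^ 2], [z ^ 3] lies above its tangent at [z = 4/7 * a]. *)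
have cub : 0 <= (1 - a) / 4 * ((z - 4/7 * a) ^+ 2 * (2 * z + 4/7 * a)).
  by apply: mulr_ge0; last apply: mulr_ge0; [lra|exact: sqr_ge0|lra].
have lin : (1 - a) * (4/7 * a + 1/4) - emin <= 0.
  by have := sqr_ge0 (a - 9/32); nra.
have h1 : z ^+ 2 * ((1 - a) * (4/7 * a + 1/4) - emin) <= 0.
  by apply: mulr_ge0_le0; rewrite ?sqr_ge0.
have h2 : a ^+ 2 * ((1 - a) * a * (16/343)) <= a ^+ 2 * (tau - 1/16).
  apply: ler_wpM2l; first exact: sqr_ge0.
  have : (1 - a) * a <= 68/115 * (47/115) by nra.
  lra.
nra.
Qed.

Lemma excess_mul_le_gap a b c : a + b + c = 1 -> 0 <= b <= 1/2 -> 0 <= c <= 6/10 ->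
  0 <= excess a b c -> (b - a) * excess a b c <= c * gap b.
Proof.
move=> abc /andP[b0 b1] /andP[c0 c1] D0.
have [ba|ab] := lerP b a.
  apply: (@le_trans _ _ 0); first by apply: mulr_le0_ge0 => //; lra.
  by apply: mulr_ge0 => //; have := gap_ge b; lra.
have h : (b - a) * excess a b c <= (b - a) * (19/500).
  by apply: ler_wpM2l; [lra|exact: excess_le].
apply: le_trans h _; have -> : b - a = 2 * b + c - 1 by lra.
(* With [19/500] in place of the excess, the claim is affine in [c] and clear at [c = 0]; at
   [c = 6/10] it is a quadratic in [b] with minimum at [47/150]. *)
have g : 0 <= c * (19/500 * (1 - 2 * b) - 6/10 * (19/500 - tau + 1/16 - (b-1/4)^+2)).
  by apply: mulr_ge0 => //; have := sqr_ge0 (b - 47/150); lra.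
have g2 : 0 <= (6/10 - c) * (1 - 2 * b) by apply: mulr_ge0; lra.
nra.
Qed.

(** Settles the end [e1 = excess a b c] in [split31_cost]; [excess_le_gap_mix] settles the end
    [e1 = gap a]. *)
Lemma excess_gap_exchange a b c : a + b + c = 1 -> 0 <= a <= 47/115 -> 0 <= b <= 1/2 ->
  c * (excess a b c - gap a) <= (1/2 - a) * (excess a b c + gap b).
Proof.
move=> abc /andP[a0 a1] /andP[b0 b1].
have -> : c = 1 - a - b by lra.
(* Up to sign the cubic part in [u], [v] is [(u + v) * (u ^ 2 + u * v + v ^ 2)],
   where [u + v <= 8/25]; the quadratic part at this centre absorbs it. *)
pose u := a - 31/100; pose v := b - 28/100.
have aE : a = u + 31/100 by rewrite /u; lra.
have bE : b = v + 28/100 by rewrite /v; lra.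
rewrite aE bE.
have hQ : 0 <= u^+2 + u * v + v^+2.
  by have := sqr_ge0 (u+v); have := sqr_ge0 u; have := sqr_ge0 v; lra.
have h : 0 <= (8/25 - u - v) * (u^+2 + u * v + v^+2).
  by apply: mulr_ge0 => //; lra.
have := sqr_ge0 (u - v); have := sqr_ge0 u; have := sqr_ge0 v.
have := sqr_ge0 (u - 1/100); have := sqr_ge0 (v - 1/100).
have := sqr_ge0 (u + 1/100); have := sqr_ge0 (v + 1/100).
nra.
Qed.

(** Settles the end [e1 = gap a] in [split4_cost]; [large_part_bound_r] settles the end
    [e1 = excess a b c]. *)
Lemma large_part_bound_l a b c : a + b + c = 1 ->
  excess a b c + a * b - 2 * gap a + (c - 1/2) * (1 - c) <= tau.
Proof.
move=> abc; have -> : c = 1 - a - b by lra.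
have := sqr_ge0 (a - 1/4); have := sqr_ge0 (a - b); have := sqr_ge0 (a + b - 1/2).
nra.
Qed.

Lemma large_part_bound_r a b c : a + b + c = 1 -> 0 <= a -> 0 <= b -> 1/2 <= c ->
  gap a <= excess a b c ->
  (1/2 - a) * (- excess a b c + a * b + (c - 1/2) * (1 - c) - tau)
    + c * (excess a b c - gap a) <= 0.
Proof.
move=> abc a0 b0 c0 AD.
have cE : c = 1 - a - b by lra.
have -> : - excess a b c + a * b + (c - 1/2) * (1 - c) = emin - (1 - c)/2.
  by rewrite cE; lra.
have sA := sqr_ge0 (a - 1/4).
have DA : excess a b c - gap a <= 1/166.
  have := sqr_ge0 (a - b); have : 0 <= (c - 1/2) * (c - 1/6) by apply: mulr_ge0; lra.
  rewrite cE; lra.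
(* The hypothesis [gap a <= excess a b c] confines [c] and [a] to a small range. *)
have c1 : c <= 53/100.
  rewrite leNgt; apply/negP => c1; move: AD; rewrite cE.
  have := sqr_ge0 (a - b); nra.
have a1 : a <= 36/100.
  rewrite leNgt; apply/negP => a1; move: AD; rewrite cE.
  nra.
have : c * (excess a b c - gap a) <= 53/100 * (1/166) by apply: ler_pM => //; lra.
nra.
Qed.

Lemma excess_le_gap_mix a b p : 0 < a -> 0 <= p <= 1 -> p * a = 1/2 - b ->
  excess a b (1 - a - b) <= (1 + 2 * p - p ^+ 2) * gap a + gap b.
Proof.
move=> a0 /andP[p0 p1] pa.
have A0 := gap_ge a.
(* For small [p] the factor of [gap a] is at least 1 and [b] is close to 1/2; otherwise the factor
   is at least [151/100]. *)
have [hp|hp] := lerP p (3/10).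
  have h : 1 * gap a <= (1 + 2 * p - p ^+ 2) * gap a.
    by apply: ler_wpM2r => //; nra.
  have hb : 1/2 - b <= 3/10 * a by rewrite -pa; apply: ler_wpM2r => //; lra.
  have := sqr_ge0 (a - 1/3); have := sqr_ge0 (a - (b - 1/2 + 3/10 * a)).
  have := sqr_ge0 (b - 1/2 + 3/10 * a); nra.
have h : 151/100 * gap a <= (1 + 2 * p - p ^+ 2) * gap a.
  by apply: ler_wpM2r => //; nra.
have := sqr_ge0 (b + a/4 - 3/8); have := sqr_ge0 (a - 46/159); lra.
Qed.

(** * Costs of the candidate bisections *)

Lemma affine_ge0 (al be x y t : R) :
  x <= t <= y -> 0 <= al * x + be -> 0 <= al * y + be -> 0 <= al * t + be.
Proof.
move=> /andP[xt ty] hx hy; have [al0|al0] := lerP 0 al.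
  by apply: le_trans hx _; rewrite lerD2r ler_wpM2l.
by apply: le_trans hy _; rewrite lerD2r ler_wnM2l // ltW.
Qed.

(** The half is V2 with a fraction [r] of V3. Each edge inside V2 excludes two edges from V2 to V3,
    so the cost exceeds [b * (1/2 - b)] by at most [(1 - 2 * r) * e2]. *)
Lemma split3_cost a b c e2 e23 r :
  a + b + c = 1 -> 0 <= b <= 1/2 -> 0 < c <= 6/10 -> 0 <= e2 <= excess a b c ->
  2 * e2 + e23 <= b * c -> 0 <= r -> r * c = 1/2 - b -> e2 + r * e23 <= tau.
Proof.
move=> abc b01 /andP[c0 c1] /andP[e20 eD] H2 r0 rc.
have h : r * e23 <= r * (b * c - 2 * e2) by apply: ler_wpM2l; [|lra].
have rbc : r * (b * c) = b * (1/2 - b) by rewrite mulrCA rc.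
suff : (1 - 2 * r) * e2 <= gap b by lra.
have B0 : 0 <= gap b by have := gap_ge b; lra.
have [hs|hs] := lerP (1 - 2 * r) 0; first exact: le_trans (mulr_le0_ge0 _ _) B0.
apply: (@le_trans _ _ ((1 - 2 * r) * excess a b c)).
  by apply: ler_wpM2l; [exact: ltW|].
rewrite -(ler_pM2l c0).
have c01 : 0 <= c <= 6/10 by rewrite ltW.
apply: le_trans _ (excess_mul_le_gap abc b01 c01 (le_trans e20 eD)).
have -> : c * ((1 - 2 * r) * excess a b c) = (c - 2 * (r * c)) * excess a b c by ring.
by have -> : c - 2 * (r * c) = b - a by lra.
Qed.

(** The half is V3 with a fraction [q] of V1. The edges from V1 to V3 cost at most
    [c * (1/2 - c) <= 1/16], which leaves [tau - 1/16] for those inside V1. *)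
Lemma split1_cost a c e1 e13 q : 0 < a <= 47/115 -> c <= 1/2 ->
  e1 <= (1 - a) * (a + c / 2) - emin -> e13 <= a * c ->
  0 <= q -> q * a = 1/2 - c -> q ^+ 2 * e1 + q * e13 <= tau.
Proof.
move=> /andP[a0 ha] ch D1 h13 q0 qa.
have h1 : q * e13 <= (1/2 - c) * c by rewrite -qa -mulrA ler_wpM2l.
have h2 : q ^+ 2 * e1 <= tau - 1/16.
  have a20 : 0 < a ^+ 2 by rewrite exprn_gt0.
  have z0 : 0 <= 1/2 - c by lra.
  rewrite -(ler_pM2r a20) mulrAC -exprMn qa.
  apply: le_trans _ (sqr_mul_excess_le a0 ha z0); apply: ler_wpM2l; first exact: sqr_ge0.
  by have -> : 1/2 - (1/2 - c) = c by lra.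
by have := sqr_ge0 (c - 1/4); lra.
Qed.

(* [U] and [W] stand for the missing densities [a * c - e13] and [a * b - e12].
   If both bisections were too expensive, eliminating [U], [W] and [e2] would give
   a strict inequality affine in [e1], which fails at both ends [gap a] and
   [excess a b c] of the range of [e1]. *)
Lemma split31_cost a b c e1 e2 U W p :
  a + b + c = 1 -> 0 < a <= 47/115 -> 0 <= b <= 1/2 -> 0 < p <= 1 -> p * a = 1/2 - b ->
  gap a < e1 -> e1 + e2 <= excess a b c -> 0 <= e2 -> 2 * e1 <= U + W ->
  (1/2 - a) * U < c * (e1 - gap a) ->
  e2 + p ^+ 2 * e1 - gap b <= p * W.
Proof.
move=> abc /andP[a0 ha] b01 /andP[p0 p1] pa Ae1 eD e20 UW hU.
rewrite leNgt; apply/negP => hW.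
have h0 : 0 < 1/2 - a by lra.
have cE : 1 - a - b = c by lra.
have a01 : 0 <= a <= 47/115 by rewrite ltW.
have p01 : 0 <= p <= 1 by rewrite ltW.
have B0 := gap_ge b; have A0 := gap_ge a.
have eq1 := excess_le_gap_mix a0 p01 pa; rewrite cE in eq1.
have eq2 := excess_gap_exchange abc a01 b01.
move: (gap a) (gap b) (excess a b c) Ae1 eD hU hW eq1 eq2 B0 A0 => A B D.
move=> Ae1 eD hU hW eq1 eq2 B0 A0.
have {hU} k1 : p * ((1/2 - a) * U) < p * (c * (e1 - A)) by rewrite ltr_pM2l.
have {hW} k2 : (1/2 - a) * (p * W) < (1/2 - a) * (e2 + p ^+ 2 * e1 - B).
  by rewrite ltr_pM2l.
have k3 : (1/2 - a) * e2 <= (1/2 - a) * (D - e1) by rewrite ler_pM2l //; lra.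
have k4 : p * (1/2 - a) * (2 * e1) <= p * (1/2 - a) * (U + W).
  by rewrite ler_pM2l ?mulr_gt0.
suff : 0 <= (2 * p * (1/2 - a) - p * c + (1/2 - a) * (1 - p ^+ 2)) * e1
    + (p * c * A - (1/2 - a) * (D - B)) by lra.
clear k1 k2 k3 k4 UW.
apply: (@affine_ge0 _ _ A D); first by rewrite ltW //=; lra.
  have : 0 <= (1/2 - a) * ((1 + 2 * p - p ^+ 2) * A + B - D).
    by apply: mulr_ge0; [exact: ltW|lra].
  by clear; lra.
have k : p * (c * (D - A)) <= p * ((1/2 - a) * (D + B)) by rewrite ler_pM2l.
have : 0 <= (1/2 - a) * (1 - p) * (p * D + B).
  apply: mulr_ge0; first by apply: mulr_ge0; lra.
  by apply: addr_ge0; [apply: mulr_ge0|]; lra.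
by move: k; clear; lra.
Qed.

(** The left side of the conclusion bounds the cost of V1 and V2 with a fraction of V3. Eliminating
    [U] makes the claim affine in [e1], so the two ends of its range suffice. *)
Lemma split4_cost a b c e1 U :
  a + b + c = 1 -> 0 <= a < 1/2 -> 0 <= b -> 1/2 <= c ->
  gap a < e1 <= excess a b c ->
  (1/2 - a) * U < c * (e1 - gap a) ->
  excess a b c + a * b - 2 * e1 + U + (c - 1/2) * (1 - c) <= tau.
Proof.
move=> abc /andP[a0 ha] b0 ch /andP[Ae1 e1D] hU.
have h0 : 0 < 1/2 - a by lra.
have g1 := large_part_bound_l abc.
have g2 := large_part_bound_r abc a0 b0 ch (le_trans (ltW Ae1) e1D).
move: (gap a) (excess a b c) Ae1 e1D hU g1 g2 => A D Ae1 e1D hU g1 g2.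
have {}g1 : 0 <= (1/2 - a) * (tau - (D + a * b - 2 * A + (c - 1/2) * (1 - c))).
  by apply: mulr_ge0; [exact: ltW|rewrite subr_ge0].
suff : 0 <= (1 - 2 * a - c) * e1 + (c * A
    - (1/2 - a) * (D + a * b + (c - 1/2) * (1 - c) - tau)).
  move=> k.
  rewrite -subr_le0 -(pmulr_rle0 _ h0); move: k hU; clear; lra.
apply: (@affine_ge0 _ _ A D); first by rewrite ltW.
  by move: g1; clear; lra.
by move: g2; clear; lra.
Qed.

(* [a], [b], [c] are the part sizes divided by [n], and [e1], [e2], [e12], [e13],
   [e23] the numbers of edges divided by [n ^ 2]; the third part is independent. *)
Lemma bisection_weights (a b c e1 e2 e12 e13 e23 : R) :
  let cost p1 p2 p3 := p1 ^+ 2 * e1 + p2 ^+ 2 * e2 + p1 * p2 * e12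
    + p1 * p3 * e13 + p2 * p3 * e23 in
  a + b + c = 1 -> 0 < a <= 47 / 115 -> 0 <= b -> 0 <= c ->
  0 <= e1 -> 0 <= e2 ->
  emin <= e1 + e2 + e12 + e13 + e23 ->
  e12 <= a * b -> e13 <= a * c ->
  2 * e1 + e12 + e13 <= a * (b + c) ->
  2 * e2 + e23 <= b * c ->
  2 * e2 + 2 * e23 <= (b + c) * c ->
  exists p1 p2 p3, [/\ [&& 0 <= p1 <= 1, 0 <= p2 <= 1 & 0 <= p3 <= 1],
    p1 * a + p2 * b + p3 * c = 1 / 2, cost p1 p2 p3 <= tau
    & cost (1 - p1) (1 - p2) (1 - p3) <= tau].
Proof.
move=> cost abc a01 b0 c0 e10 e20 he h12 h13 H1 H2 H3.
have /andP[a0 ha] := a01.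
(* The degree counts [H1] and [H2] count inner edges twice and [he] counts them once, so the surplus
   bounds them. *)
have eD : e1 + e2 <= excess a b c by move: he H1 H2; clear; lra.
have D1 : e1 <= (1 - a) * (a + c / 2) - emin.
  have -> : 1 - a = b + c by move: abc; clear; lra.
  by move: he H1 H3 e20; clear; lra.
(* If [b >= 1/2], then [c <= 1/2 - a] and the bound [D1] on [e1] is negative. *)
have bh : b < 1 / 2.
  rewrite ltNge; apply/negP => bh.
  have : (1 - a) * (a + c / 2) <= (1 - a) * (a + (1/2 - a) / 2).
    by move: ha abc bh; clear=> *; apply: ler_wpM2l; lra.
  by have := sqr_ge0 (a - 1/4); move: D1 e10; clear; lra.
have cp : 0 < c.
  rewrite lt_neqAle c0 andbT; apply/eqP => cz; move: D1 e10.
  by rewrite -cz; have := sqr_ge0 (a - 1/2); clear; lra.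
have h0 : 0 < 1/2 - a by move: ha; clear; lra.
have cmax : c <= 6/10.
  rewrite leNgt; apply/negP => c6; have : 0 <= excess a b c.
    by move: e10 e20 eD; clear; lra.
  have -> : a = 1 - b - c by move: abc; clear; lra.
  by have := sqr_ge0 (b - (1 - c) / 2); move: c6; clear; nra.
pose p3 := (1/2 - a) / c.
have p3c : p3 * c = 1/2 - a by rewrite /p3 divfK // gt_eqF.
have p3_0 : 0 <= p3 by rewrite /p3 divr_ge0 // ltW.
have p3_1 : p3 <= 1 by rewrite -(ler_pM2r cp) p3c mul1r; move: abc bh; clear; lra.
have b01 : 0 <= b <= 1/2 by rewrite b0 ltW.
have costB : e2 + (1 - p3) * e23 <= tau.
  apply: (@split3_cost a b c) => //.
  - by rewrite cp.
  - by rewrite e20; move: e10 eD; clear; lra.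
  - by rewrite subr_ge0.
  - by rewrite mulrBl p3c; move: abc; clear; lra.
have [costA|costA] := lerP (e1 + p3 * e13) tau.
  exists 1, 0, p3; split.
  - by rewrite !lexx ler01 p3_0 p3_1.
  - by rewrite p3c; clear; lra.
  - by move: costA; rewrite /cost; clear; lra.
  - by move: costB; rewrite /cost; clear; lra.
(* From here V1 with part of V3 is too costly: V1 has many inner edges and few edges to V3 are
   missing. By [UW], many edges between V1 and V2 must then be missing. *)
have Ae1 : gap a < e1.
  have : p3 * e13 <= p3 * (a * c) by apply: ler_wpM2l.
  by rewrite mulrCA p3c; move: costA; clear; lra.
have UA : (1/2 - a) * (a * c - e13) < c * (e1 - gap a).
  have : c * tau < c * (e1 + p3 * e13) by rewrite ltr_pM2l.
  have -> : c * (e1 + p3 * e13) = c * e1 + p3 * c * e13 by clear; ring.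
  by rewrite p3c; clear; lra.
have UW : 2 * e1 <= (a * c - e13) + (a * b - e12) by move: H1; clear; lra.
have [ch|ch] := lerP c (1/2).
  pose p := (1/2 - b) / a.
  have pa : p * a = 1/2 - b by rewrite /p divfK // gt_eqF.
  have p_0 : 0 < p by rewrite /p divr_gt0 // subr_gt0.
  have p_1 : p <= 1 by rewrite -(ler_pM2r a0) pa mul1r; move: abc ch; clear; lra.
  have p01 : 0 < p <= 1 by rewrite p_0.
  exists p, 1, 0; split.
  - by rewrite !lexx ler01 p_1 ltW.
  - by rewrite pa; clear; lra.
  - have := split31_cost abc a01 b01 p01 pa Ae1 eD e20 UW UA.
    have -> : p * (a * b - e12) = p * a * b - p * e12 by clear; ring.
    by rewrite pa /cost; clear; lra.
  - have : (1 - p) ^+ 2 * e1 + (1 - p) * e13 <= tau.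
      apply: (@split1_cost a c) => //; first by rewrite subr_ge0.
      by rewrite mulrBl pa; move: abc; clear; lra.
    by rewrite /cost; clear; lra.
(* As [c > 1/2], one half lies inside the independent part V3 and costs nothing. *)
pose r := (c - 1/2) / c.
have rc : r * c = c - 1/2 by rewrite /r divfK // gt_eqF.
have r0 : 0 <= r by rewrite /r divr_ge0 // subr_ge0 ltW.
have r1 : r <= 1 by rewrite -(ler_pM2r cp) rc mul1r; clear; lra.
exists 1, 1, r; split.
- by rewrite !lexx ler01 r0 r1.
- by rewrite rc; move: abc; clear; lra.
- have k1 : r * e13 <= a * (c - 1/2) by rewrite -rc mulrCA; apply: ler_wpM2l.
  have k2 : r * e23 <= b * (c - 1/2).
    by rewrite -rc mulrCA; apply: ler_wpM2l => //; move: H2 e20; clear; lra.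
  have a02 : 0 <= a < 1/2 by rewrite ltW // -subr_gt0.
  have e1D : gap a < e1 <= excess a b c by rewrite Ae1; move: eD e20; clear; lra.
  have := split4_cost abc a02 b0 (ltW ch) e1D UA.
  have -> : 1 - c = a + b by move: abc; clear; lra.
  by move: k1 k2 UW eD; rewrite /cost; clear; lra.
- by rewrite /cost; clear; lra.
Qed.

End BisectionWeights.

(** * Rounding fractional bisections *)

Section Rounding.
Variables (R : realFieldType) (V : finType) (e : rel V).
Hypotheses (e_sym : symmetric e) (e_irr : irreflexive e).
Implicit Types (p d : V -> R) (A B : {set V}).

Definition adj (x y : V) : R := (e x y)%:R.
Definition nbr_weight p x : R := \sum_y p y * adj x y.
Definition deg x : R := \sum_y adj x y.
(** Sums over ordered pairs, hence twice the fractional number of edges. *)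
Definition qform p : R := \sum_x p x * nbr_weight p x.
Definition ind A x : R := (x \in A)%:R.

Lemma adjC x y : adj x y = adj y x. Proof. by rewrite /adj e_sym. Qed.

Lemma adjxx x : adj x x = 0. Proof. by rewrite /adj e_irr. Qed.

Definition shift p a b (t : R) x : R := p x + t * ((x == a)%:R - (x == b)%:R).

Lemma sum_delta (f : V -> R) a : \sum_x (x == a)%:R * f x = f a.
Proof.
rewrite (bigD1 a) //= eqxx mul1r big1 ?addr0 // => x /negPf ->.
by rewrite mul0r.
Qed.

Lemma sum_shift p a b (t : R) (f : V -> R) :
  \sum_x shift p a b t x * f x = \sum_x p x * f x + t * (f a - f b).
Proof.
rewrite -(sum_delta f a) -(sum_delta f b) -sumrB mulr_sumr -big_split /=.
by apply: eq_bigr => x _; rewrite /shift; ring.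
Qed.

Lemma qform_shift p a b (t : R) : qform (shift p a b t) =
  qform p + 2 * t * (nbr_weight p a - nbr_weight p b) - 2 * t ^+ 2 * adj a b.
Proof.
have nw x : nbr_weight (shift p a b t) x = nbr_weight p x + t * (adj x a - adj x b).
  exact: sum_shift.
rewrite /qform sum_shift.
have -> : \sum_x p x * nbr_weight (shift p a b t) x
    = \sum_x p x * nbr_weight p x + t * (nbr_weight p a - nbr_weight p b).
  have -> : nbr_weight p a - nbr_weight p b = \sum_x p x * (adj x a - adj x b).
    by rewrite -sumrB; apply: eq_bigr => x _; rewrite (adjC a) (adjC b); ring.
  by rewrite mulr_sumr -big_split; apply: eq_bigr => x _; rewrite /= nw mulrDr [X in _ + X]mulrCA.
by rewrite !nw (adjC b a) !adjxx; ring.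
Qed.

(** Reduces the control of the complementary half to that of [qform p] and of the degree sum
    weighted by [p]. *)
Lemma qform_compl p : qform (fun x => 1 - p x) =
  \sum_x deg x - 2 * \sum_x p x * deg x + qform p.
Proof.
have nw x : nbr_weight (fun y => 1 - p y) x = deg x - nbr_weight p x.
  by rewrite /nbr_weight /deg -sumrB; apply: eq_bigr => y _; ring.
have sw : \sum_x nbr_weight p x = \sum_x p x * deg x.
  rewrite /nbr_weight exchange_big /=; apply: eq_bigr => y _.
  by rewrite mulr_sumr; apply: eq_bigr => x _; rewrite adjC.
rewrite /qform mulr_natl mulr2n -{1}sw opprD addrA -!sumrB -big_split /=.
by apply: eq_bigr => x _; rewrite nw; ring.
Qed.

Lemma eq_qform p q : p =1 q -> qform p = qform q.
Proof.
move=> pq; apply: eq_bigr => x _; rewrite pq; congr (_ * _).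
by apply: eq_bigr => y _; rewrite pq.
Qed.

Lemma sum_ind A (f : V -> R) : \sum_x ind A x * f x = \sum_(x in A) f x.
Proof.
rewrite [RHS]big_mkcond; apply: eq_bigr => x _; rewrite /ind.
by case: (x \in A); rewrite ?mul1r ?mul0r.
Qed.

(** The sign of [t] makes the linear term of [qform_shift] nonpositive; its size is the largest that
    keeps both weights in [0, 1]. *)
Lemma shift_choice p a b : 0 <= p a <= 1 -> 0 <= p b <= 1 ->
  exists t, [/\ 0 <= p a + t <= 1, 0 <= p b - t <= 1,
    t * (nbr_weight p a - nbr_weight p b) <= 0
    & (p a + t == 0) || (p a + t == 1) || (p b - t == 0) || (p b - t == 1)].
Proof.
move=> /andP[a0 a1] /andP[b0 b1].
set g := nbr_weight p a - nbr_weight p b.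
have [g0|g0] := lerP g 0.
  have [h|h] := lerP (1 - p a) (p b).
    exists (1 - p a); split; try (apply/andP; split; lra).
      by apply: mulr_ge0_le0; lra.
    by rewrite addrC subrK eqxx orbT.
  exists (p b); split; try (apply/andP; split; lra).
    by apply: mulr_ge0_le0; lra.
  by rewrite subrr eqxx !orbT.
have [h|h] := lerP (p a) (1 - p b).
  exists (- p a); split; try (apply/andP; split; lra).
    by apply: mulr_le0_ge0; lra.
  by rewrite subrr eqxx.
exists (p b - 1); split; try (apply/andP; split; lra).
  by apply: mulr_le0_ge0; lra.
by rewrite subKr eqxx !orbT.
Qed.

Lemma round_integral p a m : (forall x, 0 <= p x <= 1) ->
  (forall x, x != a -> (p x == 0) || (p x == 1)) -> \sum_x p x = m%:R ->
  p =1 ind [set x | p x == 1] /\ #|[set x | p x == 1]| = m.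
Proof.
move=> p01 pint psum; set A := [set x | p x == 1].
have pA x : x != a -> p x = ind A x.
  move/pint; rewrite /ind inE => /orP[/eqP->|/eqP->]; last by rewrite eqxx.
  by rewrite eq_sym oner_eq0.
have psum' : p a + #|A :\ a|%:R = m%:R.
  rewrite -psum (bigD1 a) //=; congr (_ + _).
  rewrite -sum1_card natr_sum big_mkcond [RHS]big_mkcond; apply: eq_bigr => x _.
  rewrite !inE; have [//|xa /=] := eqVneq x a.
  by rewrite [RHS]pA // /ind inE; case: (p x == 1).
have pa : p a = ind A a.
  have /andP[a0 a1] := p01 a.
  have km : (#|A :\ a| <= m)%N by rewrite -(ler_nat R) -psum'; lra.
  have pam : p a = (m - #|A :\ a|)%:R by rewrite natrB // -psum'; ring.
  have : (m - #|A :\ a| <= 1)%N by rewrite -(ler_nat R) -pam.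
  rewrite /ind inE; move: pam; case: (m - _)%N => [|[|k]] // -> _.
    by rewrite eq_sym oner_eq0.
  by rewrite eqxx.
have pall : p =1 ind A by move=> x; have [->|/pA] := eqVneq x a.
split=> //; apply/eqP; rewrite -(eqr_nat R) -psum; apply/eqP.
rewrite -sum1_card natr_sum big_mkcond; apply: eq_bigr => x _.
by rewrite pall /ind; case: (x \in A).
Qed.

(* The loss [p a * d a + (1 - p a) * d b], for [b] following [a], is what the
   induction preserves when a shift makes [b] integral and [a] stays fractional. *)
Lemma round_path d m : (forall x, 0 <= d x) -> forall s a p,
  path (fun x y => d y <= d x) a s -> uniq (a :: s) ->
  (forall x, 0 <= p x <= 1) ->
  (forall x, x \notin a :: s -> (p x == 0) || (p x == 1)) ->
  \sum_x p x = m%:R ->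
  exists A, [/\ #|A| = m, qform (ind A) <= qform p &
    \sum_x p x * d x - (p a * d a + (1 - p a) * head 0 (map d s))
      <= \sum_(x in A) d x].
Proof.
move=> d0; elim=> [|b s IHs] a p /=.
  move=> _ _ p01 pint psum.
  have [pA cA] : p =1 ind [set x | p x == 1] /\ #|[set x | p x == 1]| = m.
    by apply: (@round_integral p a m p01 _ psum) => x xa; apply: pint; rewrite inE.
  exists [set x | p x == 1]; split=> //; first by rewrite (eq_qform pA).
  have <- : \sum_x p x * d x = \sum_(x in [set x | p x == 1]) d x.
    by rewrite -sum_ind; apply: eq_bigr => x _; rewrite pA.
  have /andP[a0 _] := p01 a; have := mulr_ge0 a0 (d0 a); lra.
move=> /andP[dab dbs] /and3P[]; rewrite inE => /norP[ab as_] bs us p01 pint psum.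
have [t [ta tb tg tint]] := shift_choice (p01 a) (p01 b).
pose q := shift p a b t.
have qa : q a = p a + t by rewrite /q /shift eqxx (negPf ab) /= mulr1n mulr0n; ring.
have qb : q b = p b - t by rewrite /q /shift eqxx [b == a]eq_sym (negPf ab) /= mulr1n mulr0n; ring.
have qx x : x != a -> x != b -> q x = p x.
  by move=> /negPf xa /negPf xb; rewrite /q /shift xa xb subrr mulr0 addr0.
have q01 x : 0 <= q x <= 1.
  have [->|xa] := eqVneq x a; first by rewrite qa.
  by have [->|xb] := eqVneq x b; rewrite ?qb // qx.
have qsum : \sum_x q x = m%:R.
  have := sum_shift p a b t (fun=> 1); rewrite subrr mulr0 addr0 => h.
  rewrite -psum -(eq_bigr _ (fun x _ => mulr1 (p x))) -h.
  by apply: eq_bigr => x _; rewrite mulr1.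
have qF : qform q <= qform p.
  have /andP[t0 t1] := ta; rewrite /q qform_shift.
  have : 0 <= t ^+ 2 * adj a b by rewrite mulr_ge0 ?sqr_ge0 ?ler0n.
  lra.
have qd : \sum_x q x * d x = \sum_x p x * d x + t * (d a - d b) by exact: sum_shift.
have hd : 0 <= head 0 (map d s) <= d b.
  by case: s dbs {IHs as_ bs us pint} => [|c s] /=; rewrite ?lexx d0 //= => /andP[].
have /andP[h0 h1] := hd; have /andP[ta0 ta1] := ta; have /andP[tb0 tb1] := tb.
have [qaint|qbint] : ((q a == 0) || (q a == 1)) \/ ((q b == 0) || (q b == 1)).
  by rewrite qa qb; apply/orP; rewrite orbA.
- have [||A [cA FA dA]] := IHs b q dbs _ q01 _ qsum.
  + by rewrite /= bs.
  + move=> x xbs; have [->//|xa] := eqVneq x a.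
    move: xbs (xbs); rewrite {1}inE => /norP[xb _] xbs.
    by rewrite qx //; apply: pint; rewrite inE negb_or xa.
  exists A; split=> //; first exact: le_trans FA qF.
  apply: le_trans dA; rewrite qd qb.
  have : 0 <= (1 - (p b - t)) * (d b - head 0 (map d s)) by apply: mulr_ge0; lra.
  have : 0 <= (p a + t) * (d a - d b) by apply: mulr_ge0; lra.
  lra.
- have [|||A [cA FA dA]] := IHs a q _ _ q01 _ qsum.
  + by case: s dbs {IHs as_ bs us pint hd h0 h1} => //= c s /andP[cb ->]; rewrite (le_trans cb).
  + by rewrite /= as_.
  + move=> x; rewrite inE => /norP[xa xs].
    have [->//|xb] := eqVneq x b; rewrite qx //.
    by apply: pint; rewrite !inE !negb_or xa xb.
  exists A; split=> //; first exact: le_trans FA qF.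
  apply: le_trans dA; rewrite qd qa.
  have : 0 <= (1 - (p a + t)) * (d b - head 0 (map d s)) by apply: mulr_ge0; lra.
  lra.
Qed.


Lemma edges_in_double A :
  (\sum_(x in A) \sum_(y in A) e x y = 2 * edges_in e A)%N.
Proof.
pose P (u : V * V) := (u.1 \in A) && (u.2 \in A) && e u.1 u.2.
rewrite pair_big /=.
have -> : (\sum_(u | (u.1 \in A) && (u.2 \in A)) e u.1 u.2 = \sum_(u | P u) 1)%N.
  by rewrite [RHS]big_mkcondr; apply: eq_bigr => u _; case: (e _ _).
rewrite (partition_big (fun u => [set u.1; u.2])
  (mem [set E in edges e | E \subset A])) /=; last first.
  move=> [x y] /andP[/andP[/= xA yA] exy]; rewrite !inE; apply/andP; split.
    by apply/existsP; exists x; apply/existsP; exists y; rewrite exy eqxx.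
  by apply/subsetP => z; rewrite !inE => /orP[] /eqP->.
rewrite (eq_bigr (fun=> 2%N)); first by rewrite sum_nat_const mulnC.
move=> E; rewrite !inE => /andP[/existsP[x /existsP[y /andP[exy /eqP ->]]] /subsetP sA].
have xy : x != y by apply: contraTneq exy => ->; rewrite e_irr.
have xA : x \in A by apply: sA; rewrite !inE eqxx.
have yA : y \in A by apply: sA; rewrite !inE eqxx orbT.
have -> : 2%N = #|[set (x, y); (y, x)]| by rewrite cards2 xpair_eqE negb_and xy.
rewrite sum1_card; apply: eq_card => -[u v]; rewrite !inE /= unfold_in /P /=.
apply/idP/idP => [/andP[/andP[_ euv] /eqP huv]|].
  have uv : u != v by apply: contraTneq euv => ->; rewrite e_irr.
  have : u \in [set x; y] by rewrite -huv !inE eqxx.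
  have : v \in [set x; y] by rewrite -huv !inE eqxx orbT.
  by rewrite !inE !xpair_eqE => /orP[]/eqP ? /orP[]/eqP ?; subst; rewrite ?eqxx ?orbT // in uv *.
by move=> /orP[]/eqP[-> ->]; rewrite xA yA ?exy ?(e_sym y x) ?exy ?eqxx //= setUC.
Qed.

Lemma qform_ind A : qform (ind A) = 2 * (edges_in e A)%:R.
Proof.
rewrite -natrM -edges_in_double natr_sum /qform sum_ind; apply: eq_bigr => x _.
by rewrite /nbr_weight sum_ind natr_sum.
Qed.

Lemma deg_le x : 0 <= deg x <= #|V|%:R.
Proof.
rewrite sumr_ge0 => [|y _]; last exact: ler0n.
by rewrite -sum1_card natr_sum; apply: ler_sum => y _; rewrite ler_nat leq_b1.
Qed.

Lemma round_weights p m : (0 < #|V|)%N -> (forall x, 0 <= p x <= 1) ->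
  \sum_x p x = m%:R ->
  exists A, [/\ #|A| = m, qform (ind A) <= qform p &
    \sum_x p x * deg x - #|V|%:R <= \sum_(x in A) deg x].
Proof.
move=> V0 p01 psum.
pose r x y := deg y <= deg x.
have r_total : total r by move=> x y; exact: le_total.
have := sort_sorted r_total (enum V); have := mem_sort r (enum V).
have := sort_uniq r (enum V); have := size_sort r (enum V).
case: (sort r (enum V)) => [|a s] /=; first by rewrite -cardE => h; rewrite -h in V0.
rewrite enum_uniq => _ us ms ps.
have d0 x : 0 <= deg x by have /andP[] := deg_le x.
have [|A [cA FA dA]] := round_path d0 ps us p01 _ psum.
  by move=> x; rewrite ms mem_enum.
exists A; split=> //; apply: le_trans dA; rewrite lerD2l lerN2.
have /andP[a0 a1] := deg_le a; have /andP[pa0 pa1] := p01 a.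
have h : head 0 (map deg s) <= #|V|%:R.
  by case: (s) => [|b s'] /=; [exact: ler0n|have /andP[] := deg_le b].
have : p a * deg a <= p a * #|V|%:R by apply: ler_wpM2l.
have : (1 - p a) * head 0 (map deg s) <= (1 - p a) * #|V|%:R.
  by apply: ler_wpM2l; rewrite ?subr_ge0.
lra.
Qed.

Lemma D2b_le_weights p (M : R) : ~~ odd #|V| -> (0 < #|V|)%N ->
  (forall x, 0 <= p x <= 1) -> 2 * \sum_x p x = #|V|%:R ->
  qform p <= 2 * M -> qform (fun x => 1 - p x) <= 2 * M ->
  (D2b e)%:R <= M + #|V|%:R.
Proof.
move=> Vev V0 p01 psum hp hq.
have Vm : #|V| = (2 * #|V|./2)%N by rewrite mul2n even_halfK.
have psum' : \sum_x p x = #|V|./2%:R by move: psum; rewrite {1}Vm natrM; lra.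
have [A [cA FA dA]] := round_weights V0 p01 psum'.
have bA : balanced A.
  rewrite /balanced -(eqn_add2l #|A|) cardsC cA [X in _ == X]Vm.
  by rewrite addnn mul2n.
have [_ /(_ A bA) hD] := D2bP e Vev.
have {hD} : ((D2b e)%:R <= (edges_in e A)%:R :> R) || ((D2b e)%:R <= (edges_in e (~: A))%:R :> R).
  by rewrite !ler_nat -leq_max.
have eA := qform_ind A.
have eC : 2 * (edges_in e (~: A))%:R
    = \sum_x deg x - 2 * \sum_(x in A) deg x + qform (ind A).
  rewrite -qform_ind -sum_ind -qform_compl; apply: eq_qform => x.
  by rewrite /ind inE; case: (x \in A); rewrite /= ?subrr ?subr0.
have n0 : 0 <= #|V|%:R :> R := ler0n _ _.
rewrite qform_compl in hq.
move=> /orP[]; lra.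
Qed.

Definition cut A B : R := \sum_(x in A) \sum_(y in B) adj x y.

Lemma cutC A B : cut A B = cut B A.
Proof.
rewrite /cut exchange_big; apply: eq_bigr => x _; apply: eq_bigr => y _.
exact: adjC.
Qed.

Lemma cut_ge0 A B : 0 <= cut A B.
Proof. by apply: sumr_ge0 => x _; apply: sumr_ge0 => y _; exact: ler0n. Qed.

Lemma cut_le_degree A B k : (forall x, x \in A -> (#|[set y in B | e x y]| <= k)%N) ->
  cut A B <= #|A|%:R * k%:R.
Proof.
move=> hk; rewrite mulr_natl -sumr_const; apply: ler_sum => x /hk.
rewrite -(ler_nat R); apply: le_trans.
rewrite -sum1_card natr_sum big_mkcond [leRHS]big_mkcond; apply: ler_sum => y _.
by rewrite inE /adj; case: (y \in B); case: (e x y).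
Qed.

Lemma cut_le A B : cut A B <= #|A|%:R * #|B|%:R.
Proof.
by apply: cut_le_degree => x _; apply: subset_leq_card; apply/subsetP => y; rewrite inE => /andP[].
Qed.

Section ThreeParts.
Variables (X Y : {set V}).
Let V1 := ~: X.
Let V2 := X :\: Y.
Let V3 := X :&: Y.

Lemma sum_three_parts (f : V -> R) :
  \sum_x f x = \sum_(x in V1) f x + \sum_(x in V2) f x + \sum_(x in V3) f x.
Proof.
rewrite (bigID (mem X)) /= addrC -addrA; congr (_ + _).
  by apply: eq_bigl => x; rewrite inE.
rewrite (bigID (mem Y)) /= addrC; congr (_ + _); apply: eq_bigl => x; rewrite inE //.
by rewrite andbC.
Qed.

Definition part_weight (p1 p2 p3 : R) x :=
  if x \in X then if x \in Y then p3 else p2 else p1.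

Lemma sum_part_weight (p1 p2 p3 : R) (f : V -> R) :
  \sum_x part_weight p1 p2 p3 x * f x
    = p1 * \sum_(x in V1) f x + p2 * \sum_(x in V2) f x + p3 * \sum_(x in V3) f x.
Proof.
rewrite sum_three_parts !mulr_sumr /part_weight; congr (_ + _ + _); apply: eq_bigr => x.
- by rewrite inE => /negPf ->.
- by rewrite inE => /andP[/negPf -> ->].
- by rewrite inE => /andP[-> ->].
Qed.

Lemma qform_part_weight (p1 p2 p3 : R) :
  qform (part_weight p1 p2 p3) =
    p1 ^+ 2 * cut V1 V1 + p2 ^+ 2 * cut V2 V2 + p3 ^+ 2 * cut V3 V3
    + 2 * (p1 * p2 * cut V1 V2 + p1 * p3 * cut V1 V3 + p2 * p3 * cut V2 V3).
Proof.
have nw A : \sum_(x in A) nbr_weight (part_weight p1 p2 p3) x =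
    p1 * cut A V1 + p2 * cut A V2 + p3 * cut A V3.
  rewrite /cut !mulr_sumr -!big_split /=; apply: eq_bigr => x _.
  exact: sum_part_weight.
by rewrite /qform sum_part_weight !nw (cutC V2 V1) (cutC V3 V1) (cutC V3 V2); ring.
Qed.

End ThreeParts.

End Rounding.

(** * K4-free graphs *)

Lemma K4_free_common_nbrs (V : finType) (e : rel V) x y z w :
  symmetric e -> irreflexive e -> K4_free e -> e x y -> e x z -> e x w ->
  e y z -> e y w -> ~~ e z w.
Proof.
move=> e_sym e_irr K4 xy xz xw yz yw; apply/negP => zw; apply: K4.
have ne u v : e u v -> u != v by move=> uv; apply: contraTneq uv => ->; rewrite e_irr.
exists [set x; y; z; w].
  rewrite -!setUA !cardsU1 !inE cards1.
  by rewrite !negb_or !(ne _ _ xy, ne _ _ xz, ne _ _ xw, ne _ _ yz, ne _ _ yw, ne _ _ zw).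
apply/forall_inP => u uK; apply/forall_inP => v vK; apply/implyP.
move: uK vK; rewrite !inE -!orbA.
by move=> /or4P[] /eqP-> /or4P[] /eqP->; rewrite ?eqxx // e_sym.
Qed.

Lemma greedy_tripartition (R : realFieldType) (V : finType) (e : rel V) :
  symmetric e -> irreflexive e -> K4_free e -> 0 < \sum_x deg R e x ->
  exists X Y : {set V}, [/\ ~: X != set0,
    forall x, (#|[set y | e x y]| <= #|X|)%N,
    forall x, x \in X -> (#|[set y in X | e x y]| <= #|X :&: Y|)%N
    & forall x y, x \in X :&: Y -> y \in X :&: Y -> ~~ e x y].
Proof.
move=> e_sym e_irr K4 esum.
have [z0 [w0 zw0]] : exists z w, e z w.
  suff : [exists z, [exists w, e z w]] by case/existsP=> z /existsP[w]; exists z, w.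
  apply: contraTT esum => /existsPn h; rewrite -leNgt.
  apply: sumr_le0 => x _; apply: sumr_le0 => y _.
  by have /existsPn /(_ y) /negPf := h x; rewrite /adj => ->.
pose N x := [set y | e x y].
have [x _ xmax] := @arg_maxnP V z0 predT (fun x => #|N x|) isT.
have Nx : w0 \in N z0 by rewrite inE.
have : (0 < #|N x|)%N.
  by apply: leq_trans (xmax z0 isT); apply/card_gt0P; exists w0.
case/card_gt0P => y0 y0x.
have [y yx ymax] := @arg_maxnP V y0 (mem (N x)) (fun y => #|N x :&: N y|) y0x.
exists (N x), (N y); split.
- by apply/set0Pn; exists x; rewrite !inE e_irr.
- by move=> z; exact: xmax.
- move=> z zx; apply: leq_trans (ymax z zx); apply: subset_leq_card.
  by apply/subsetP => v; rewrite !inE.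
- move=> z w; move: yx; rewrite !inE => xy /andP[xz yz] /andP[xw yw].
  exact: K4_free_common_nbrs e_sym e_irr K4 xy xz xw yz yw.
Qed.

Lemma D2b_le_dense (R : realFieldType) (V : finType) (e : rel V) :
  symmetric e -> irreflexive e -> K4_free e -> ~~ odd #|V| ->
  2 * emin * #|V|%:R ^+ 2 < \sum_x deg R e x ->
  (D2b e)%:R <= tau * #|V|%:R ^+ 2 + #|V|%:R :> R.
Proof.
move=> e_sym e_irr K4 Vev dense; pose c := cut R e.
have n20 : 0 <= #|V|%:R ^+ 2 :> R := sqr_ge0 _.
have [|X [Y [V10 hX hY hI]]] := @greedy_tripartition R V e e_sym e_irr K4.
  apply: le_lt_trans dense; apply: mulr_ge0 => //; lra.
set V1 := ~: X in V10; pose V2 := X :\: Y; pose V3 := X :&: Y.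
have V0 : (0 < #|V|)%N.
  by case/set0Pn: V10 => x _; apply/card_gt0P; exists x.
pose n : R := #|V|%:R.
have n0 : 0 < n by rewrite ltr0n.
have cX : #|X|%:R = #|V2|%:R + #|V3|%:R :> R by rewrite -natrD addnC cardsID.
have cV : #|V1|%:R + #|V2|%:R + #|V3|%:R = n.
  by rewrite -addrA -cX -natrD addnC cardsC.
have cut_split (A : {set V}) : \sum_(x in A) deg R e x = c A V1 + c A V2 + c A V3.
  rewrite /c /cut -!big_split /=; apply: eq_bigr => x _; exact: sum_three_parts.
have c33 : c V3 V3 = 0.
  rewrite /c /cut big1 // => x x3; rewrite big1 // => y y3.
  by rewrite /adj (negPf (hI x y x3 y3)).
have c21 : c V2 V1 = c V1 V2 := cutC R e_sym _ _.
have c31 : c V3 V1 = c V1 V3 := cutC R e_sym _ _.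
have c32 : c V3 V2 = c V2 V3 := cutC R e_sym _ _.
have total : \sum_x deg R e x = c V1 V1 + c V2 V2 + 2 * (c V1 V2 + c V1 V3 + c V2 V3).
  by rewrite (sum_three_parts X Y) !cut_split c21 c31 c32 c33; ring.
have cT (A : {set V}) : cut R e A setT = \sum_(x in A) deg R e x.
  by apply: eq_bigr => x _; apply: eq_bigl => y; rewrite inE.
have degX (A : {set V}) : \sum_(x in A) deg R e x <= #|A|%:R * (#|V2|%:R + #|V3|%:R).
  rewrite -cT -cX; apply: cut_le_degree => x _; apply: leq_trans (hX x).
  by apply: subset_leq_card; apply/subsetP => y; rewrite !inE.
have cutX (A : {set V}) : c A X = c A V2 + c A V3.
  rewrite /c /cut -big_split /=; apply: eq_bigr => x _.
  rewrite (bigID (mem Y)) /= addrC; congr (_ + _); apply: eq_bigl => y; rewrite !inE //.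
  by rewrite andbC.
have degY (A : {set V}) : A \subset X -> c A X <= #|A|%:R * #|V3|%:R.
  by move=> /subsetP AX; apply: cut_le_degree => x /AX; exact: hY.
have H1 := degX V1; rewrite cut_split in H1.
have H2 : c V2 V2 + c V2 V3 <= #|V2|%:R * #|V3|%:R.
  by rewrite -cutX; apply: degY; exact: subsetDl.
have H3 : c V2 V2 + 2 * c V2 V3 <= (#|V2|%:R + #|V3|%:R) * #|V3|%:R.
  have := degY V3 (subsetIl _ _); rewrite cutX c33 c32 => h; lra.
have Hmax : 2 * emin * n < #|V2|%:R + #|V3|%:R.
  rewrite -(ltr_pM2r n0); apply: lt_le_trans (_ : \sum_x deg R e x <= _).
    by have -> : 2 * emin * n * n = 2 * emin * n ^+ 2 by ring.
  have := degX [set: V]; rewrite cardsT mulrC (eq_bigl predT) // => x.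
  by rewrite inE.
have h12 : c V1 V2 <= #|V1|%:R * #|V2|%:R := cut_le R e V1 V2.
have h13 : c V1 V3 <= #|V1|%:R * #|V3|%:R := cut_le R e V1 V3.
have V1pos : 0 < #|V1|%:R :> R by rewrite ltr0n card_gt0.
have V2pos : 0 <= #|V2|%:R :> R by [].
have V3pos : 0 <= #|V3|%:R :> R by [].
have c11p : 0 <= c V1 V1 := cut_ge0 R e _ _.
have c22p : 0 <= c V2 V2 := cut_ge0 R e _ _.
have nn : n != 0 by rewrite gt_eqF.
have n2 : 0 < n ^+ 2 by rewrite exprn_gt0.
have quot (x : R) : exists y, x = y * n by exists (x / n); rewrite divfK.
have quot2 (x : R) : exists y, x = y * n ^+ 2.
  by exists (x / n ^+ 2); rewrite divfK // gt_eqF.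
have [v1 v1E] := quot #|V1|%:R; have [v2 v2E] := quot #|V2|%:R.
have [v3 v3E] := quot #|V3|%:R.
have [e1 e1E] := quot2 (c V1 V1 / 2); have [e2 e2E] := quot2 (c V2 V2 / 2).
have [e12 e12E] := quot2 (c V1 V2); have [e13 e13E] := quot2 (c V1 V3).
have [e23 e23E] := quot2 (c V2 V3).
have {}e1E : c V1 V1 = 2 * e1 * n ^+ 2 by rewrite -mulrA -e1E; lra.
have {}e2E : c V2 V2 = 2 * e2 * n ^+ 2 by rewrite -mulrA -e2E; lra.
have qE p1 p2 p3 : qform e (part_weight X Y p1 p2 p3) =
    2 * n ^+ 2 * (p1 ^+ 2 * e1 + p2 ^+ 2 * e2 + p1 * p2 * e12 + p1 * p3 * e13 + p2 * p3 * e23).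
  rewrite (qform_part_weight e_sym) -/V1 -/V2 -/V3 -!/(c _ _) c33 e1E e2E e12E e13E e23E.
  by clear; ring.
rewrite total in dense.
rewrite v1E v2E v3E e1E e2E e12E e13E e23E in
  cV dense H1 H2 H3 Hmax h12 h13 V1pos V2pos V3pos c11p c22p.
have U1 (x y : R) : x * n <= y * n -> x <= y by rewrite ler_pM2r.
have U2 (x y : R) : x * n ^+ 2 <= y * n ^+ 2 -> x <= y by rewrite ler_pM2r.
have [||||||||||||p1 [p2 [p3 [/and3P[p1_01 p2_01 p3_01] psum cost1 cost2]]]] :=
  @bisection_weights R v1 v2 v3 e1 e2 e12 e13 e23.
- by apply: (mulIf nn); rewrite !mulrDl mul1r.
- apply/andP; split; first by rewrite -(pmulr_lgt0 _ n0).
  by apply: U1; move: cV Hmax; clear; lra.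
- by rewrite -(pmulr_lge0 _ n0).
- by rewrite -(pmulr_lge0 _ n0).
- by apply: U2; move: c11p; clear; lra.
- by apply: U2; move: c22p; clear; lra.
- by apply: U2; move: dense; rewrite -/n; clear; lra.
- by apply: U2; move: h12; clear; lra.
- by apply: U2; move: h13; clear; lra.
- by apply: U2; move: H1; clear; lra.
- by apply: U2; move: H2; clear; lra.
- by apply: U2; move: H3; clear; lra.
have qle q1 q2 q3 : q1 ^+ 2 * e1 + q2 ^+ 2 * e2 + q1 * q2 * e12 + q1 * q3 * e13
    + q2 * q3 * e23 <= tau -> qform e (part_weight X Y q1 q2 q3) <= 2 * (tau * n ^+ 2).
  move=> h; rewrite qE; have := ler_wpM2l (ltW n2) h; clear; lra.
apply: (@D2b_le_weights R V e e_sym e_irr (part_weight X Y p1 p2 p3)) => //.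
- by move=> x; rewrite /part_weight; case: ifP => _ //; case: ifP.
- have := sum_part_weight X Y p1 p2 p3 (fun=> 1).
  under eq_bigr do rewrite mulr1.
  rewrite !sumr_const -/V1 -/V2 -/V3 v1E v2E v3E => ->.
  have -> : p1 * (v1 * n) + p2 * (v2 * n) + p3 * (v3 * n)
    = (p1 * v1 + p2 * v2 + p3 * v3) * n by clear; ring.
  by rewrite psum -/n; clear; field.
- exact: qle.
- rewrite (@eq_qform _ _ _ _ (part_weight X Y (1 - p1) (1 - p2) (1 - p3))); first exact: qle.
  by move=> x; rewrite /part_weight; case: ifP => _ //; case: ifP.
Qed.

Lemma D2b_le (R : realFieldType) (V : finType) (e : rel V) :
  symmetric e -> irreflexive e -> K4_free e -> ~~ odd #|V| -> (0 < #|V|)%N ->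
  (D2b e)%:R <= tau * #|V|%:R ^+ 2 + #|V|%:R :> R.
Proof.
move=> e_sym e_irr K4 Vev V0.
have [sparse|] := lerP (\sum_x deg R e x) (2 * emin * #|V|%:R ^+ 2); last exact: D2b_le_dense.
have half : qform e (fun=> 1 / 2 : R) = (\sum_x deg R e x) / 4.
  rewrite /qform /nbr_weight mulr_suml; apply: eq_bigr => x _.
  by rewrite -mulr_sumr -/(deg R e x); field.
have hq : qform e (fun=> 1 / 2 : R) <= 2 * (tau * #|V|%:R ^+ 2).
  by rewrite half; move: sparse; clear; lra.
apply: (@D2b_le_weights R V e e_sym e_irr (fun=> 1 / 2)) => //.
- by move=> _; apply/andP; split; lra.
- by rewrite sumr_const -mulr_natr; clear; field.
- by rewrite (@eq_qform _ _ _ _ (fun=> 1 / 2)) // => _; lra.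
Qed.

Theorem theorem1p8 (V : finType) (e : rel V) (n : nat)
    (e_sym : symmetric e) (e_irr : irreflexive e) (e_K4_free : K4_free e)
    (card_V : #|V| = n) (n_even : ~~ odd n) (n_large : (10 ^ 5 < n)%N) :
  (D2b e)%:R < 74 / 1000 * n%:R ^+ 2 :> rat.
Proof.
have n_pos : (0 < n)%N by apply: leq_ltn_trans n_large.
rewrite -card_V in n_even n_pos *.
apply: le_lt_trans (D2b_le rat e_sym e_irr e_K4_free n_even n_pos) _.
move: n_large; rewrite card_V -(ltr_nat rat) natrX; move: (n%:R) => x hx.
have : 0 < x * (x - 10 ^+ 5) by apply: mulr_gt0; lra.
lra.
Qed.
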